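(* Let $\omega=(T,c,T_1,\dots,T_m,c_1,\dots,c_m,\alpha_1,\dots,\alpha_m)\in\Omega$ be such that $\langle x,Tx\rangle$ is a Legendre form on $\mathcal H$, and suppose that $\varphi(\omega)\neq\pm\infty$. Then the optimal value function $\varphi(\cdot)$ is continuous at $\omega$ if and only if the following two conditions are satisfied: (i) $\mathrm{Sol}(QPR_\omega)=\{0\}$; (ii) the system $g_i(x,\omega)\leqslant 0$, $i=1,\dots,m$, is regular.
   Context: $\mathcal H$ is a real Hilbert space with inner product $\langle\cdot,\cdot\rangle$ and norm $\|\cdot\|$; $\mathcal L(\mathcal H)$ is the space of continuous linear operators on $\mathcal H$ with the operator norm; $m\geqslant 1$ is a fixed integer. $\Omega$ is the set of all $\omega=(T,c,T_1,\dots,T_m,c_1,\dots,c_m,\alpha_1,\dots,\alpha_m)\in \mathcal L(\mathcal H)\times\mathcal H\times\mathcal L(\mathcal H)^m\times\mathcal H^m\times\mathbb R^m$ such that $T$ is self-adjoint and each $T_i$ is self-adjoint and positive semidefinite. Product spaces carry the max norm, so $\|\omega-\omega'\|$ is the maximum of the norms of the componentwise differences. For $\omega\in\Omega$ and $x\in\mathcal H$: $f(x,\omega)=\frac12\langle x,Tx\rangle+\langle c,x\rangle$; $g_i(x,\omega)=\frac12\langle x,T_ix\rangle+\langle c_i,x\rangle+\alpha_i$ for $i=1,\dots,m$; $F(\omega)=\{x\in\mathcal H: g_i(x,\omega)\leqslant 0,\ i=1,\dots,m\}$. The optimal value function $\varphi:\Omega\to\mathbb R\cup\{\pm\infty\}$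 is $\varphi(\omega)=\inf\{f(x,\omega):x\in F(\omega)\}$ (possibly $-\infty$) if $F(\omega)\ne\emptyset$, and $\varphi(\omega)=+\infty$ if $F(\omega)=\emptyset$. Continuity of $\varphi$ at $\omega$ means $\varphi(\omega^k)\to\varphi(\omega)$ for every sequence $\omega^k\to\omega$ in $\Omega$. The recession cone of the constraint set is $0^+F(\omega)=\{v\in\mathcal H: T_iv=0,\ \langle c_i,v\rangle\leqslant 0,\ i=1,\dots,m\}$. $(QPR_\omega)$ is the problem of minimizing $\frac12\langle v,Tv\rangle$ over $v\in 0^+F(\omega)$, and $\mathrm{Sol}(QPR_\omega)$ is its set of (global) minimizers. The system $g_i(x,\omega)\leqslant0$, $i=1,\dots,m$, is regular if there is $x^0\in\mathcal H$ with $g_i(x^0,\omega)<0$ for all $i=1,\dots,m$. A quadratic form $Q:\mathcal H\to\mathbb R$ is a Legendre form if it is weakly (sequentially) lower semicontinuous and $x_k\to x_0$ in norm whenever $x_k$ converges weakly to $x_0$ and $Q(x_k)\to Q(x_0)$. *)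

(* Defs.v *)
From HB Require Import structures.
From mathcomp Require Import all_boot all_order all_algebra.
From mathcomp Require Import all_classical all_reals all_analysis.
Set Implicit Arguments.
Unset Strict Implicit.
Unset Printing Implicit Defensive.
Import Order.TTheory GRing.Theory Num.Theory numFieldNormedType.Exports.
Local Open Scope classical_set_scope.
Local Open Scope ring_scope.

(* A real Hilbert space is a complete normed module [H] with a form
   [dot : {dot H for idfun}] (bilinear, symmetric, positive definite) that
   induces the norm; [is_inner_product] is that last compatibility. *)
Definition is_inner_product (R : realType) (H : completeNormedModType R)
    (dot : {dot H for idfun}) : Prop :=
  forall x : H, `|x| ^+ 2 = dot x x.

(* Meaningful when [A] is linear and continuous, so that the set is bounded;
   it always contains [`|A 0|], also when [H] is the zero space. *)
Definition opnorm (R : realType) (H : completeNormedModType R)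
    (A : H -> H) : R :=
  sup [set `|A x| | x in [set x : H | `|x| <= 1]].

Record param (R : realType) (H : completeNormedModType R) (m : nat) := Param {
  pT : {linear H -> H};
  pc : H;
  pTi : 'I_m -> {linear H -> H};
  pci : 'I_m -> H;
  palpha : 'I_m -> R
}.

Section QP.
Context (R : realType) (H : completeNormedModType R) (dot : {dot H for idfun}).
Context (m : nat).
Implicit Types (w : param H m) (x v : H) (i : 'I_m).

Definition self_adjoint (A : H -> H) : Prop :=
  forall x y, dot x (A y) = dot (A x) y.

Definition positive_semidefinite (A : H -> H) : Prop :=
  forall x, 0 <= dot x (A x).

Definition Omega : set (param H m) := [set w |
  [/\ continuous (pT w), self_adjoint (pT w) &
      forall i, [/\ continuous (pTi w i), self_adjoint (pTi w i) &
                    positive_semidefinite (pTi w i)]]].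

Definition param_dist w w' : R :=
  Num.max (opnorm (pT w \- pT w'))
  (Num.max `|pc w - pc w'|
  (Num.max (\big[Num.max/0]_(i < m) opnorm (pTi w i \- pTi w' i))
  (Num.max (\big[Num.max/0]_(i < m) `|pci w i - pci w' i|)
           (\big[Num.max/0]_(i < m) `|palpha w i - palpha w' i|)))).

Definition f x w : R := 2^-1 * dot x (pT w x) + dot (pc w) x.

Definition g i x w : R :=
  2^-1 * dot x (pTi w i x) + dot (pci w i) x + palpha w i.

Definition F w : set H := [set x | forall i, g i x w <= 0].

(* [ereal_inf set0 = +oo], which is the convention for an empty [F w]. *)
Definition phi w : \bar R := ereal_inf [set (f x w)%:E | x in F w].

Definition phi_continuous_at w : Prop :=
  forall w_ : nat -> param H m, (forall k, Omega (w_ k)) ->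
    param_dist (w_ k) w @[k --> \oo] --> (0 : R) ->
    phi (w_ k) @[k --> \oo] --> phi w.

Definition recession_cone w : set H :=
  [set v | forall i, pTi w i v = 0 /\ dot (pci w i) v <= 0].

Definition SolQPR w : set H := [set v | recession_cone w v /\
  forall u, recession_cone w u ->
    2^-1 * dot v (pT w v) <= 2^-1 * dot u (pT w u)].

Definition regular w : Prop := exists x0 : H, forall i, g i x0 w < 0.

Definition weakly_cvg (x_ : nat -> H) (x0 : H) : Prop :=
  forall y : H, dot y (x_ k) @[k --> \oo] --> dot y x0.

Definition weakly_lsc (Q : H -> R) : Prop :=
  forall (x_ : nat -> H) (x0 : H), weakly_cvg x_ x0 ->
    ((Q x0)%:E <= limn_einf (fun k => (Q (x_ k))%:E))%E.

(* Intended for quadratic forms [Q], as in [fun x => dot x (A x)] with [A]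
   linear, continuous and self-adjoint. *)
Definition legendre_form (Q : H -> R) : Prop :=
  weakly_lsc Q /\
  forall (x_ : nat -> H) (x0 : H), weakly_cvg x_ x0 ->
    Q (x_ k) @[k --> \oo] --> Q x0 -> x_ k @[k --> \oo] --> x0.

End QP.

(* Main.v *)
Require Import Defs.
From mathcomp Require Import all_boot all_order all_algebra.
From mathcomp Require Import all_classical all_reals all_analysis.
From mathcomp Require Import lra ring.
Import Order.TTheory GRing.Theory Num.Theory numFieldNormedType.Exports.
Local Open Scope classical_set_scope.
Local Open Scope ring_scope.

(** Necessity is proved with two perturbations.  If the constraint system is not
regular, adding any positive constant to all the [palpha w i] makes it
infeasible, so the value [+oo] occurs arbitrarily close to [w].  Since the value
at [w] is finite, [dot v (pT w v)] is nonnegative on the recession cone, along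
which feasible points can be moved freely; if it vanished at a nonzero recession
vector [v], subtracting from [pT w] any positive multiple of the identity would
make the objective unbounded below along [v], and the value [-oo] would occur
arbitrarily close to [w].  Neither is compatible with continuity at a finite
value ([phi_continuous_avoids]).

For sufficiency, the value cannot jump up because a nearly optimal point can be
moved towards a Slater point: it then satisfies all the constraints strictly,
hence stays feasible for nearby parameters ([phi_near_lt]).  It cannot jump down
either ([phi_near_ge]).  Otherwise points feasible for nearby problems have
objective values at most some [a] below the value at [w].  If infinitely many
of them stay in a ball, a weak limit of these is feasible for [w] with value at
most [a], because positive semidefinite forms and Legendre forms are weakly
lower semicontinuous ([bounded_almost_solution]).  If they escape to infinity,
their normalized directions accumulate weakly at a recession vector [u] with
[dot u (pT w u) <= 0], so [u = 0]; the Legendre property turns weak convergence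
to [0] into strong convergence, which unit vectors do not allow
([almost_solution_not_escaping]).

The compactness used here is that bounded sequences have weakly convergent
subsequences ([bounded_weakly_cvg_subsequence]).  It is obtained without
representing linear functionals: a minimal norm argument in convex sets gives a
weak limit along an ultrafilter, and a subsequence of the differences to this
limit whose terms are more and more nearly orthogonal to each other is weakly
null. *)

(** * Inner products *)

Section InnerProduct.
Context {R : realType} {H : completeNormedModType R} (dot : {dot H for idfun}).
Implicit Types (x y z : H) (a b : R).

Lemma dotC x y : dot x y = dot y x.
Proof. by rewrite hermC expr0 mul1r. Qed.

Lemma dotDl x y z : dot (x + y) z = dot x z + dot y z.
Proof. exact: linearDl. Qed.

Lemma dotDr x y z : dot x (y + z) = dot x y + dot x z.
Proof. by rewrite dotC dotDl !(dotC x). Qed.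

Lemma dotZl a x y : dot (a *: x) y = a * dot x y.
Proof. exact: linearZl_LR. Qed.

Lemma dotZr a x y : dot x (a *: y) = a * dot x y.
Proof. by rewrite dotC dotZl dotC. Qed.

Lemma dotNl x y : dot (- x) y = - dot x y.
Proof. by rewrite -scaleN1r dotZl mulN1r. Qed.

Lemma dotNr x y : dot x (- y) = - dot x y.
Proof. by rewrite dotC dotNl dotC. Qed.

Lemma dot0l x : dot 0 x = 0.
Proof. by rewrite -(scale0r x) dotZl mul0r. Qed.

Lemma dot0r x : dot x 0 = 0.
Proof. by rewrite dotC dot0l. Qed.

Definition dotE := (dotDl, dotDr, dotNl, dotNr, dotZl, dotZr).

Lemma dot_eq0 x : dot x x = 0 -> x = 0.
Proof.
move=> xx0; apply: contrapT => /eqP/(@neq0_dnorm_gt0 _ _ _ dot).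
by rewrite xx0 ltxx.
Qed.

Hypothesis dot_norm : is_inner_product dot.

Lemma cauchy_schwarz x y : `|dot x y| <= `|x| * `|y|.
Proof.
have [->|x0] := eqVneq x 0; first by rewrite dot0l !normr0 mul0r.
have [->|y0] := eqVneq y 0; first by rewrite dot0r !normr0 mulr0.
have xy_gt0 : 0 < `|x| * `|y| by rewrite mulr_gt0 ?normr_gt0.
have := sqr_ge0 `|(`|y| *: x) - (`|x| *: y)|.
have := sqr_ge0 `|(`|y| *: x) + (`|x| *: y)|.
rewrite !dot_norm !dotE -!dot_norm (dotC y x) => p n.
have p' : 0 <= `|x| * `|y| * (`|x| * `|y| + dot x y) by lra.
have n' : 0 <= `|x| * `|y| * (`|x| * `|y| - dot x y) by lra.
move: p' n'; rewrite !pmulr_rge0// => p' n'.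
by rewrite ler_norml; apply/andP; split; lra.
Qed.

Lemma dot_continuous y : continuous (dot y).
Proof.
move=> x; apply/cvgrPdist_lt => e e0.
have d0 : 0 < e / (`|y| + 1) by rewrite divr_gt0// ltr_wpDl.
have : \forall t \near x, `|x - t| < e / (`|y| + 1).
  by apply: cvgr_dist_lt d0; exact: cvg_id.
apply: filterS => t; rewrite ltr_pdivlMr ?ltr_wpDl// => xt.
rewrite -dotNr -dotDr (le_lt_trans (cauchy_schwarz _ _))//.
by rewrite mulrC; apply: le_lt_trans xt; rewrite ler_wpM2l// lerDl.
Qed.

(** The parallelogram identity, written around the midpoint. *)
Lemma midpoint_sqr x y :
  `|x - y| ^+ 2 = 2 * `|x| ^+ 2 + 2 * `|y| ^+ 2 - 4 * `|2^-1 *: (x + y)| ^+ 2.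
Proof. by rewrite !dot_norm !dotE (dotC y x); lra. Qed.

End InnerProduct.

(** * Weak sequential compactness of bounded sets *)

Definition midpoint_convex {R : realType} {H : completeNormedModType R}
    (C : set H) : Prop :=
  forall x y, C x -> C y -> C (2^-1 *: (x + y)).

Section WeakCompactness.
Context {R : realType} {H : completeNormedModType R} (dot : {dot H for idfun}).
Hypothesis dot_norm : is_inner_product dot.

(** A closed convex set [C] containing [U]-almost all terms of a bounded
sequence is nonempty, and has vectors whose norm is close to its distance [d C]
to the origin; when [d C] is close to the
supremum [D] of these distances, the parallelogram identity forces the vectors
of [C] of norm at most [D + e] to be close to each other.  So these slices form
a Cauchy filter, and its limit lies in every [C]. *)
Lemma closed_convex_common_point (U : set_system nat) {PU : ProperFilter U}
    (x : nat -> H) (M : R) : (forall k, `|x k| <= M) ->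
  exists u : H, forall C : set H, closed C -> midpoint_convex C ->
    (\forall k \near U, C (x k)) -> C u.
Proof.
move=> xM.
pose adm (C : set H) :=
  [/\ closed C, midpoint_convex C & \forall k \near U, C (x k)].
pose d (C : set H) := inf [set `|z| | z in C].
have adm_ex C : adm C -> exists2 z, C z & `|z| <= M.
  by move=> [_ _ /filter_ex[k Ck]]; exists (x k).
have d_lb C z : C z -> d C <= `|z|.
  by move=> Cz; apply: ge_inf; [exists 0 => _ [t _ <-]|exists z].
have d_ge0 C : adm C -> 0 <= d C.
  move=> /adm_ex[z Cz _]; apply: lb_le_inf; first by exists `|z|, z.
  by move=> _ [t _ <-].
have d_le_M C : adm C -> d C <= M.
  by move=> /adm_ex[z Cz]; apply: le_trans; exact: d_lb.
have admT : adm setT by split; [exact: closedT| |exact: filterE].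
pose D := sup [set d C | C in adm].
have hsD : has_sup [set d C | C in adm].
  by split; [exists (d setT), setT|exists M => _ [C /d_le_M ? <-]].
have d_le_D C : adm C -> d C <= D.
  by move=> aC; apply: sup_upper_bound => //; exists C.
have D_ge0 : 0 <= D by rewrite (le_trans (d_ge0 _ admT))// d_le_D.
have admI C C' : adm C -> adm C' -> adm (C `&` C').
  move=> [c1 m1 u1] [c2 m2 u2]; split; first exact: closedI.
    by move=> a b [? ?] [? ?]; split; [exact: m1|exact: m2].
  exact: filterI.
pose idx := [set Ce : set H * R | adm Ce.1 /\ 0 < Ce.2].
pose slice (Ce : set H * R) := Ce.1 `&` [set z | `|z| <= D + Ce.2].
pose G := filter_from idx slice.
have GF : Filter G.
  apply: filter_from_filter; first by exists (setT, 1); split => /=.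
  move=> [C e] [C' e'] [/= aC e0] [/= aC' e'0].
  exists (C `&` C', Num.min e e').
    by split => /=; [exact: admI|rewrite lt_min e0].
  move=> z [/= [Cz C'z] zD]; split; split => //=; apply: (le_trans zD).
    by rewrite lerD2l ge_min lexx.
  by rewrite lerD2l ge_min lexx orbT.
have slice_ex Ce : idx Ce -> slice Ce !=set0.
  case: Ce => C e [/= aC e0].
  have [z0 Cz0 _] := adm_ex C aC.
  have hiC : has_inf [set `|z| | z in C].
    by split; [exists `|z0|, z0|exists 0 => _ [t _ <-]].
  have [_ [z Cz <-] zd] := inf_adherent e0 hiC.
  exists z; split => //=; apply/ltW/(lt_le_trans zd).
  by rewrite lerD2r; exact: d_le_D.
have GP : ProperFilter G by exact: filter_from_proper.
have Gcauchy : cauchy G.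
  apply/cauchy_exP => eps eps0.
  (* [16 * (D + 1) * e] bounds the squared diameter of the slice of a set
     [C] with [D - e < d C]: see [gap] below. *)
  pose e := Num.min 1 (eps ^+ 2 / (16 * (D + 1))).
  have e0 : 0 < e by rewrite lt_min ltr01 divr_gt0 ?exprn_gt0//; lra.
  have [_ [C aC <-]] := sup_adherent e0 hsD; rewrite -/D => DC.
  have iC : idx (C, e) by [].
  have [z0 [/= Cz0 z0D]] := slice_ex _ iC.
  exists z0; exists (C, e) => // z [/= Cz zD].
  rewrite -ball_normE /=.
  have [_ mC _] := aC.
  have := d_lb C _ (mC _ _ Cz0 Cz); have := d_ge0 _ aC; have := d_le_D _ aC.
  move=> dD d0 dm.
  suff : `|z0 - z| ^+ 2 < eps ^+ 2.
    by rewrite ltr_pXn2r ?nnegrE//; exact: ltW.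
  have e1 : e <= 1 by rewrite ge_min lexx.
  have e2 : 16 * (D + 1) * e <= eps ^+ 2.
    by rewrite mulrC -ler_pdivlMr ?ge_min ?lexx ?orbT//; lra.
  have sqr0 : `|z0| ^+ 2 <= (D + e) ^+ 2.
    by rewrite ler_pXn2r ?nnegrE//; lra.
  have sqr1 : `|z| ^+ 2 <= (D + e) ^+ 2 by rewrite ler_pXn2r ?nnegrE//; lra.
  have sqr2 : d C ^+ 2 <= `|2^-1 *: (z0 + z)| ^+ 2.
    by rewrite ler_pXn2r ?nnegrE//; lra.
  apply: lt_le_trans e2; rewrite (midpoint_sqr _ dot_norm).
  have gap : (D + e) ^+ 2 - d C ^+ 2 <= 2 * e * (2 * D + e).
    rewrite subr_sqr ler_pM//; lra.
  have : 0 <= e * (1 - e) by rewrite mulr_ge0//; lra.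
  nra.
have Gcvg : cvg G by exact/cauchy_cvgP.
exists (lim G) => C cC mC uC.
have aC : adm C by [].
have GC : G C by exists (C, 1) => // z [].
by apply: cC => B /Gcvg GB; apply: filter_ex (filterI GC GB).
Qed.

Lemma closed_halfspace (y : H) (a : R) :
  closed [set z | a <= dot y z] /\ midpoint_convex [set z | a <= dot y z].
Proof.
split.
  have -> : [set z | a <= dot y z] = dot y @^-1` [set t | a <= t] by [].
  apply: closed_comp; last exact: closed_ge.
  by move=> z _; exact: (dot_continuous _ dot_norm).
by move=> z z' /= az az'; rewrite dotZr dotDr; lra.
Qed.

(** Testing the common point above on half-spaces: along an ultrafilter, each
half-space or its complement is visited almost always. *)
Lemma weak_ultralimit (U : set_system nat) {UU : UltraFilter U}
    (x : nat -> H) (M : R) : (forall k, `|x k| <= M) ->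
  exists u : H, forall y, dot y (x k) @[k --> U] --> dot y u.
Proof.
move=> /closed_convex_common_point-/(_ U _)[u uP]; exists u => y.
have up z a : dot z u < a -> \forall k \near U, dot z (x k) < a.
  move=> ua; have [ax|] := in_ultra_setVsetC [set k | a <= dot z (x k)] UU.
    have [cC mC] := closed_halfspace z a.
    by have := uP _ cC mC ax; rewrite /= leNgt ua.
  by apply: filterS => k /= /negP; rewrite -ltNge.
apply/cvgrPdist_lt => e e0.
have h1 : \forall k \near U, dot y (x k) < dot y u + e.
  by apply: up; rewrite ltrDl.
have h2 : \forall k \near U, dot (- y) (x k) < dot (- y) u + e.
  by apply: up; rewrite ltrDl.
apply: filterS2 h1 h2 => k; rewrite !dotNl => ? ?.
by rewrite ltr_norml; apply/andP; split; lra.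
Qed.

(** If [dot y (z k)] stayed away from [0] infinitely often, an ultrafilter on
these indices would produce a weak limit [u] orthogonal to all the [z i], hence
to itself, so that [u = 0] and [dot y u = 0], which is absurd. *)
Lemma asymptotically_orthogonal_weakly_null (z : nat -> H) (M : R) :
  (forall k, `|z k| <= M) ->
  (forall i, dot (z i) (z k) @[k --> \oo] --> (0 : R)) ->
  weakly_cvg dot z 0.
Proof.
move=> zM zz y; rewrite dot0r; apply/cvgrPdist_lt => e e0.
apply: contrapT => notnear.
pose B := [set k | e <= `|dot y (z k)|].
have PW : ProperFilter (within B \oo).
  apply: Build_ProperFilter_ex => A wA; apply: contrapT => /forallNP nA.
  apply: notnear; have : \forall k \near \oo, B k -> A k by exact: wA.
  apply: filterS => k BA; rewrite sub0r normrN.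
  by rewrite ltNge; apply/negP => /BA; exact: nA.
have [V [UV wV]] := ultraFilterLemma PW.
have [u uP] := weak_ultralimit V z M zM.
have ooV : \oo `<=` V.
    by move=> A ooA; apply: wV; apply: filterS ooA => k.
have u_z i : dot (z i) u = 0.
  have : dot (z i) (z k) @[k --> V] --> (0 : R) by move=> A /(zz i)/ooV.
  by move/(norm_cvg_unique (uP (z i))).
have u0 : u = 0.
  apply: (dot_eq0 dot); apply: (norm_cvg_unique (uP u)) => //=.
  by under eq_fun do rewrite dotC u_z; exact: cvg_cst.
have : \forall k \near V, `|dot y u - dot y (z k)| < e.
  by move/cvgrPdist_lt: (uP y); apply.
have VB : V B by apply: wV; apply: withinT.
move=> /(filterI VB) /filter_ex[k [/= Bk]].
by rewrite u0 dot0r sub0r normrN ltNge Bk.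
Qed.

(** Subtracting a weak limit along an ultrafilter makes the sequence weakly null
along it, so that terms nearly orthogonal to finitely many earlier ones occur
arbitrarily far. *)
Theorem bounded_weakly_cvg_subsequence (x : nat -> H) (M : R) :
  (forall k, `|x k| <= M) ->
  exists s : nat -> nat, exists u : H,
    (forall n, (n <= s n)%N) /\ weakly_cvg dot (x \o s) u.
Proof.
move=> xM.
have [U [UU ooU]] := ultraFilterLemma (eventually_filter : ProperFilter \oo).
have [u uP] := weak_ultralimit U x M xM.
pose z k := x k - u.
have zU y : dot y (z k) @[k --> U] --> (0 : R).
  under eq_fun do rewrite dotDr dotNr.
  by rewrite -(subrr (dot y u)); apply: cvgB; [exact: uP|exact: cvg_cst].
pose good (l : seq nat) k :=
  (size l <= k)%N /\
  forall i, i \in l -> `|dot (z i) (z k)| <= (size l).+1%:R^-1.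
have goodP l : exists k, good l k.
  have near_all (l' : seq nat) : \forall k \near U, forall i, i \in l' ->
      `|dot (z i) (z k)| <= (size l).+1%:R^-1.
    elim: l' => [|j l' IH]; first by apply: filterE.
    have : \forall k \near U, `|0 - dot (z j) (z k)| <= (size l).+1%:R^-1.
      by move/cvgrPdist_le: (zU (z j)); apply; rewrite invr_gt0.
    apply: filterS2 IH => k IH; rewrite sub0r normrN => jk i.
    by rewrite inE => /orP[/eqP->|/IH].
  have /(filterI (near_all l)) : \forall k \near U, (size l <= k)%N.
    exact/ooU/nbhs_infty_ge.
  by move=> /filter_ex[k [? ?]]; exists k.
have [next nextP] := choice goodP.
pose L n := iter n (fun l => next l :: l) [::].
pose s n := next (L n).
have sizeL n : size (L n) = n by elim: n => //= n ->.
have memL i n : (i < n)%N -> s i \in L n.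
  elim: n => // n IH; rewrite ltnS leq_eqVlt inE => /orP[/eqP->|/IH ->].
    by rewrite eqxx.
  by rewrite orbT.
have s_ge n : (n <= s n)%N by have [] := nextP (L n); rewrite sizeL.
exists s, u; split=> //.
have zs : weakly_cvg dot (z \o s) 0.
  apply: (asymptotically_orthogonal_weakly_null _ (M + `|u|)).
    by move=> k; rewrite (le_trans (ler_normB _ _))// lerD2r.
  move=> i; apply/cvgrPdist_le => e e0.
  near=> k; rewrite sub0r normrN.
  have sik : s i \in L k by apply: memL; near: k; exact: nbhs_infty_gt.
  apply: (@le_trans _ _ k.+1%:R^-1).
    by have [_ /(_ _ sik)] := nextP (L k); rewrite sizeL.
  by apply: ltW; near: k; exact: (near_infty_natSinv_lt (PosNum e0)).
move=> y; have zsu := cvgD (zs y) (cvg_cst (dot y u)).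
rewrite dot0r add0r in zsu.
have -> : (fun k => dot y ((x \o s) k)) = (fun k => dot y (z (s k)) + dot y u).
  by apply/funext => k; rewrite /= dotDr dotNr subrK.
exact: zsu.
Unshelve. all: by end_near. Qed.

End WeakCompactness.

(** * Quadratic forms under weak convergence *)

Lemma subseq_cvg {T : topologicalType} (u : nat -> T) (l : T) (s : nat -> nat) :
  (forall n, (n <= s n)%N) -> u k @[k --> \oo] --> l ->
  u (s k) @[k --> \oo] --> l.
Proof.
move=> sge ul; apply: cvg_comp ul.
move=> A [N _ NA]; exists N => // n Nn; apply: NA.
exact: leq_trans (sge n).
Qed.

Section QuadraticForms.
Context {R : realType} {H : completeNormedModType R} (dot : {dot H for idfun}).
Hypothesis dot_norm : is_inner_product dot.

(** Weak lower semicontinuity in the form in which it combines with other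
eventual properties. *)
Lemma weakly_lsc_near (Q : H -> R) (x : nat -> H) (x0 : H) (c : R) :
  weakly_lsc dot Q -> weakly_cvg dot x x0 -> c < Q x0 ->
  \forall k \near \oo, c < Q (x k).
Proof.
move=> lscQ /lscQ Qx0 cQ.
have : (c%:E < limn_einf (fun k => (Q (x k))%:E))%E.
  by apply: lt_le_trans Qx0; rewrite lte_fin.
rewrite [limn_einf _]limf_einfE => /ereal_sup_gt[_ [V ooV <-] cV].
apply: filterS ooV => k Vk; rewrite -lte_fin; apply: (lt_le_trans cV).
by apply: ereal_inf_lbound; exists k.
Qed.

Lemma weakly_lsc_le_lim (Q : H -> R) (x : nat -> H) (x0 : H)
    (b : nat -> R) (l : R) :
  weakly_lsc dot Q -> weakly_cvg dot x x0 ->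
  (forall k, Q (x k) <= b k) -> b k @[k --> \oo] --> l -> Q x0 <= l.
Proof.
move=> lscQ xx0 Qb bl; rewrite leNgt; apply/negP => lQ.
have lm : l < (l + Q x0) / 2 by lra.
have mQ : (l + Q x0) / 2 < Q x0 by lra.
have near_m := weakly_lsc_near _ _ _ _ lscQ xx0 mQ.
have [k [mk km]] := filter_ex (filterI near_m (cvgr_lt _ bl _ lm)).
by have := lt_trans (lt_le_trans mk (Qb k)) km; rewrite ltxx.
Qed.

(** Expanding [0 <= dot (x k - x0) (A (x k - x0))] bounds the form from below
by an affine function of [x k]. *)
Lemma psd_le_weak_lim (A : {linear H -> H}) (x : nat -> H) (x0 : H)
    (b : nat -> R) (l : R) :
  self_adjoint dot A -> positive_semidefinite dot A -> weakly_cvg dot x x0 ->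
  (forall k, dot (x k) (A (x k)) <= b k) -> b k @[k --> \oo] --> l ->
  dot x0 (A x0) <= l.
Proof.
move=> sA pA xx0 Qb bl.
have low : 2 * dot (A x0) (x k) - dot (A x0) x0 @[k --> \oo] -->
    2 * dot (A x0) x0 - dot (A x0) x0.
  by apply: cvgB; [apply: cvgMr; exact: xx0|exact: cvg_cst].
have -> : dot x0 (A x0) = 2 * dot (A x0) x0 - dot (A x0) x0.
  by rewrite (dotC _ x0); lra.
apply: (ler_cvg_to low bl); apply: nearW => k.
apply: le_trans (Qb k).
have := pA (x k - x0); rewrite linearB !dotE.
rewrite (sA x0 (x k)) (dotC _ (x k) (A x0)) (dotC _ x0 (A x0)); lra.
Qed.

(** If [A v] were not [0], the form would take a negative value at
[v - t *: A v] for small [t > 0]. *)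
Lemma psd_isotropic_ker (A : {linear H -> H}) (v : H) :
  self_adjoint dot A -> positive_semidefinite dot A ->
  dot v (A v) <= 0 -> A v = 0.
Proof.
move=> sA pA vAv; apply: contrapT => /eqP Av0.
pose p := dot (A v) (A v); pose q := dot (A v) (A (A v)).
have p0 : 0 < p by rewrite /p -dot_norm exprn_gt0// normr_gt0.
have q0 : 0 <= q by exact: pA.
pose t := p / (q + 1).
have t0 : 0 < t by rewrite divr_gt0//; lra.
have tq : t * (q + 1) = p by rewrite divfK// gt_eqF//; lra.
have AE : A (v - t *: A v) = A v - t *: A (A v) by rewrite linearB linearZZ.
have := pA (v - t *: A v); rewrite AE !dotE.
rewrite (sA v (A v)) -/p -/q; nra.
Qed.

End QuadraticForms.

(** * Dependence of the data on the parameter *)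

Section Perturbation.
Context {R : realType} {H : completeNormedModType R} (dot : {dot H for idfun}).
Hypothesis dot_norm : is_inner_product dot.
Context {m : nat}.
Implicit Types (w : param H m) (A B : {linear H -> H}) (i : 'I_m).

Lemma opnorm_sub_ge A B (x : H) : continuous A -> continuous B ->
  `|A x - B x| <= opnorm (A \- B) * `|x|.
Proof.
move=> cA cB.
have bounded (C : {linear H -> H}) : continuous C ->
    exists2 r, 0 < r & forall y, `|C y| <= r * `|y|.
  by move=> /linear_bounded_continuous/linear_boundedP/pinfty_ex_gt0.
have [a a0 Aa] := bounded A cA; have [b b0 Bb] := bounded B cB.
have hs : has_sup [set `|(A \- B) y| | y in [set y : H | `|y| <= 1]].
  split; first by exists `|(A \- B) 0|, 0 => //=; rewrite normr0.
  exists (a + b) => _ [y /= y1 <-]; rewrite (le_trans (ler_normB _ _))//.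
  by rewrite lerD// (le_trans (Aa _), le_trans (Bb _))// ler_piMr// ltW.
have [->|x0] := eqVneq x 0; first
  by rewrite (linear0 A) (linear0 B) subrr normr0 mulr0.
have nx : 0 < `|x| by rewrite normr_gt0.
rewrite -ler_pdivrMr//; apply: sup_upper_bound => //.
exists (`|x|^-1 *: x) => /=.
  by rewrite normrZ normfV normr_id mulVf// gt_eqF.
by rewrite (linearZZ A) (linearZZ B) -scalerBr normrZ normfV normr_id mulrC.
Qed.

Lemma opnorm_le (A : H -> H) (a : R) :
  (forall x, `|x| <= 1 -> `|A x| <= a) -> opnorm A <= a.
Proof.
move=> Aa; apply: ge_sup; first by exists `|A 0|, 0 => //=; rewrite normr0.
by move=> _ [x /= x1 <-]; exact: Aa.
Qed.

Lemma param_dist_ge_objective w w' :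
  opnorm (pT w \- pT w') <= param_dist w w' /\
  `|pc w - pc w'| <= param_dist w w'.
Proof. by rewrite /param_dist !le_max !lexx ?orbT. Qed.

Lemma param_dist_ge_constraint w w' i :
  [/\ opnorm (pTi w i \- pTi w' i) <= param_dist w w',
      `|pci w i - pci w' i| <= param_dist w w' &
      `|palpha w i - palpha w' i| <= param_dist w w'].
Proof.
rewrite /param_dist !le_max; split.
- by rewrite (le_bigmax _ (fun i => opnorm (pTi w i \- pTi w' i)))/= ?orbT.
- by rewrite (le_bigmax _ (fun i => `|pci w i - pci w' i|))/= ?orbT.
- by rewrite (le_bigmax _ (fun i => `|palpha w i - palpha w' i|))/= ?orbT.
Qed.

Lemma param_dist_ge0 w w' : 0 <= param_dist w w'.
Proof. by rewrite /param_dist !le_max normr_ge0 orbT. Qed.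

Lemma param_dist_le w w' (a : R) : 0 <= a ->
  opnorm (pT w \- pT w') <= a -> `|pc w - pc w'| <= a ->
  (forall i, [/\ opnorm (pTi w i \- pTi w' i) <= a,
      `|pci w i - pci w' i| <= a & `|palpha w i - palpha w' i| <= a]) ->
  param_dist w w' <= a.
Proof.
move=> a0 h1 h2 h; rewrite /param_dist !ge_max h1 h2 /=.
by apply/and3P; split; apply: bigmax_le => // i _; have [] := h i.
Qed.

Lemma quadratic_perturbation (A B : {linear H -> H}) (b c x : H) (e : R) :
  continuous A -> continuous B -> opnorm (A \- B) <= e -> `|b - c| <= e ->
  `|(2^-1 * dot x (A x) + dot b x) - (2^-1 * dot x (B x) + dot c x)|
    <= e * (2^-1 * `|x| ^+ 2 + `|x|).
Proof.
move=> cA cB ABe bce.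
have -> : (2^-1 * dot x (A x) + dot b x) - (2^-1 * dot x (B x) + dot c x) =
    2^-1 * dot x (A x - B x) + dot (b - c) x by rewrite !dotE; lra.
apply: le_trans (ler_normD _ _) _; rewrite mulrDr lerD//.
  rewrite normrM ger0_norm// mulrCA ler_pM2l//.
  rewrite (le_trans (cauchy_schwarz _ dot_norm _ _))// expr2 mulrCA ler_wpM2l//.
  by rewrite (le_trans (opnorm_sub_ge _ _ _ cA cB))// ler_wpM2r.
by rewrite (le_trans (cauchy_schwarz _ dot_norm _ _))// ler_wpM2r.
Qed.

Lemma objective_perturbation w w' x : Omega dot w -> Omega dot w' ->
  `|f dot x w - f dot x w'| <= param_dist w w' * (1 + `|x|) ^+ 2.
Proof.
move=> [cT _ _] [cT' _ _].
have [h1 h2] := param_dist_ge_objective w w'.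
apply: le_trans (quadratic_perturbation _ _ _ _ _ _ cT cT' h1 h2) _.
rewrite ler_wpM2l ?param_dist_ge0//.
by have := normr_ge0 x; nra.
Qed.

Lemma constraint_perturbation w w' x i : Omega dot w -> Omega dot w' ->
  `|g dot i x w - g dot i x w'| <= param_dist w w' * (1 + `|x|) ^+ 2.
Proof.
move=> [_ _ /(_ i)[cT _ _]] [_ _ /(_ i)[cT' _ _]].
have [h1 h2 h3] := param_dist_ge_constraint w w' i.
rewrite /g opprD addrACA (le_trans (ler_normD _ _))//.
apply: le_trans (lerD (quadratic_perturbation _ _ _ _ _ _ cT cT' h1 h2) h3) _.
rewrite -[X in _ + X <= _]mulr1 -mulrDr ler_wpM2l ?param_dist_ge0//.
by have := normr_ge0 x; nra.
Qed.

Lemma affine_perturbation w w' x i :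
  `|(dot (pci w i) x + palpha w i) - (dot (pci w' i) x + palpha w' i)|
    <= param_dist w w' * (1 + `|x|).
Proof.
have [_ h2 h3] := param_dist_ge_constraint w w' i.
rewrite opprD addrACA -dotNl -dotDl addrC mulrDr mulr1.
rewrite (le_trans (ler_normD _ _))// lerD//.
by rewrite (le_trans (cauchy_schwarz _ dot_norm _ _))// ler_wpM2r.
Qed.

End Perturbation.

(** * Necessity *)

Section Necessity.
Context {R : realType} {H : completeNormedModType R} (dot : {dot H for idfun}).
Hypothesis dot_norm : is_inner_product dot.
Context {m : nat}.
Implicit Types (w : param H m) (x v : H) (i : 'I_m).

Lemma quadratic_line (A : {linear H -> H}) (c x v : H) (t : R) :
  self_adjoint dot A ->
  2^-1 * dot (x + t *: v) (A (x + t *: v)) + dot c (x + t *: v) =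
  (2^-1 * dot x (A x) + dot c x) + t * (dot (A x) v + dot c v)
    + t ^+ 2 * (2^-1 * dot v (A v)).
Proof.
move=> sA; have -> : A (x + t *: v) = A x + t *: A v.
  by rewrite linearD linearZZ.
by rewrite !dotE (sA x v) (dotC _ v (A x)); lra.
Qed.

Lemma recession_feasible w x v (t : R) : Omega dot w ->
  F dot w x -> recession_cone dot w v -> 0 <= t -> F dot w (x + t *: v).
Proof.
move=> [_ _ Ow] Fx vrec t0 i; have [_ sA _] := Ow i.
have [Tv0 cv] := vrec i; apply: le_trans (Fx i).
rewrite /g quadratic_line// -(sA x v) Tv0 !dot0r.
by have := mulr_ge0_le0 t0 cv; lra.
Qed.

Lemma phi_le w x : F dot w x -> (phi dot w <= (f dot x w)%:E)%E.
Proof. by move=> Fx; apply: ereal_inf_lbound; exists x. Qed.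

(** Along [x + t *: v] the objective is a quadratic polynomial in [t] with
negative leading coefficient. *)
Lemma phi_ninfty_of_recession w x v : Omega dot w ->
  F dot w x -> recession_cone dot w v -> dot v (pT w v) < 0 ->
  phi dot w = -oo%E.
Proof.
move=> Ow Fx vrec vTv.
suff below : forall r : R, (phi dot w <= r%:E)%E.
  case: (phi dot w) below => [s /(_ (s - 1)%R)|/(_ 0%R)|//]; last by [].
  by rewrite lee_fin lerBrDr gerDl ler10.
move=> r; have [_ sT _] := Ow.
pose a := - (2^-1 * dot v (pT w v)).
pose b := dot (pT w x) v + dot (pc w) v.
pose c := f dot x w.
have a0 : 0 < a by rewrite /a; lra.
(* With this step the line has descended from the value [c] to below [r]. *)
pose t := 1 + (`|b| + `|c| + `|r|) / a.
have q0 : 0 <= (`|b| + `|c| + `|r|) / a.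
  by apply: divr_ge0; [rewrite !addr_ge0|exact: ltW].
have t1 : 1 <= t by rewrite /t; lra.
have ta : t * a = a + (`|b| + `|c| + `|r|).
  by rewrite /t mulrDl mul1r divfK// gt_eqF.
have t0 : 0 <= t by lra.
apply: le_trans (phi_le _ _ (recession_feasible _ _ _ _ Ow Fx vrec t0)) _.
rewrite lee_fin /f quadratic_line// -/(f dot x w) -/b -/c.
have -> : 2^-1 * dot v (pT w v) = - a by rewrite /a opprK.
have bb := ler_norm b; have cc := ler_norm c.
have rr : - `|r| <= r by rewrite lerNl -normrN ler_norm.
have nr := normr_ge0 r; have nc := normr_ge0 c.
have -> : t ^+ 2 * - a = - (t * (t * a)) by ring.
rewrite ta.
have : 0 <= (t - 1) * (a + `|c| + `|r|) by rewrite mulr_ge0//; lra.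
have : 0 <= t * (`|b| - b) by rewrite mulr_ge0//; lra.
nra.
Qed.

(** The perturbations by which discontinuity is detected: the first destroys the
feasibility of a system that is not regular, the second boundedness from below
along an isotropic recession vector. *)
Definition tighten w (a : R) : param H m :=
  Param (pT w) (pc w) (pTi w) (pci w) (fun i => palpha w i + a).

Definition lower_curvature w (a : R) : param H m :=
  Param ((pT w \- (a \*: idfun : H -> H)) : {linear H -> H})
    (pc w) (pTi w) (pci w) (palpha w).

Lemma tighten_Omega w a : Omega dot w -> Omega dot (tighten w a).
Proof. by case=> ? ? ?; split. Qed.

Lemma lower_curvature_Omega w a :
  Omega dot w -> Omega dot (lower_curvature w a).
Proof.
case=> cT sT ?; split => //=.
  move=> x; apply: cvgB; first exact: cT.
  by apply: cvgZr; exact: cvg_id.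
by move=> x y; rewrite /= !dotE sT.
Qed.

Lemma opnorm_subrr (A : H -> H) (a : R) : 0 <= a -> opnorm (A \- A) <= a.
Proof. by move=> a0; apply: opnorm_le => x _; rewrite /= subrr normr0. Qed.

Lemma tighten_dist w a : 0 <= a -> param_dist (tighten w a) w <= a.
Proof.
move=> a0; apply: param_dist_le => //=; rewrite ?subrr ?normr0 ?opnorm_subrr//.
by move=> i; rewrite opnorm_subrr// subrr normr0 addrAC subrr add0r ger0_norm.
Qed.

Lemma lower_curvature_dist w a :
  0 <= a -> param_dist (lower_curvature w a) w <= a.
Proof.
move=> a0; apply: param_dist_le => //=; rewrite ?subrr ?normr0//.
  apply: opnorm_le => x x1 /=.
  by rewrite addrAC subrr add0r normrN normrZ ger0_norm// ler_piMr.
by move=> i; rewrite opnorm_subrr// !subrr !normr0.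
Qed.

(** Continuity at a finite value forbids, arbitrarily close to the parameter,
both infeasibility and unboundedness from below. *)
Lemma phi_continuous_avoids w (pert : R -> param H m) (l : \bar R) :
  phi_continuous_at dot w ->
  (forall a, 0 < a -> Omega dot (pert a)) ->
  (forall a, 0 < a -> param_dist (pert a) w <= a) ->
  (forall a, 0 < a -> phi dot (pert a) = l) -> phi dot w = l.
Proof.
move=> cont Op dp lp.
have inv0 k : 0 < k.+1%:R^-1 :> R by rewrite invr_gt0.
have : phi dot (pert k.+1%:R^-1) @[k --> \oo] --> phi dot w.
  apply: (cont (fun k => pert k.+1%:R^-1)) => [k|]; first exact: Op.
  apply: (@squeeze_cvgr _ _ _ _ (fun=> 0) (fun k => k.+1%:R^-1)).
  - by apply: nearW => k; rewrite param_dist_ge0 dp.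
  - exact: cvg_cst.
  - exact: cvg_harmonic.
under eq_fun do rewrite lp//.
by move=> h; apply: (cvg_unique _ h (cvg_cst l)); exact: ereal_hausdorff.
Qed.

(** For [0 < a], a point feasible for [tighten w a] is a Slater point of [w]. *)
Lemma continuous_regular w : Omega dot w -> phi dot w <> +oo%E ->
  phi_continuous_at dot w -> regular dot w.
Proof.
move=> Ow phi_fin cont; apply: contrapT => nreg; apply: phi_fin.
apply: (phi_continuous_avoids _ (tighten w) _ cont) => a a0.
- exact: tighten_Omega.
- exact/tighten_dist/ltW.
have F0 : F dot (tighten w a) = set0.
  apply/seteqP; split => // x Fx; apply: nreg; exists x => i.
  by have := Fx i; rewrite /g /=; lra.
by rewrite /phi F0 image_set0 ereal_inf0.
Qed.

Lemma phi_npinfty_feasible w : phi dot w <> +oo%E -> F dot w !=set0.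
Proof.
by apply: contra_notP => /set0P/negP/negPn/eqP F0; rewrite /phi F0 image_set0
  ereal_inf0.
Qed.

Lemma recession_cone0 w : recession_cone dot w 0.
Proof. by move=> i; rewrite linear0 dot0r. Qed.

(** A nonzero minimizer of the recession problem is isotropic, and
[lower_curvature] makes it a direction of negative curvature. *)
Lemma continuous_SolQPR w : Omega dot w -> phi dot w <> +oo%E ->
  phi dot w <> -oo%E -> phi_continuous_at dot w -> SolQPR dot w = [set 0].
Proof.
move=> Ow /phi_npinfty_feasible[x Fx] phi_fin cont.
have form_ge0 u : recession_cone dot w u -> 0 <= dot u (pT w u).
  move=> urec; rewrite leNgt; apply/negP => uTu; apply: phi_fin.
  exact: phi_ninfty_of_recession Ow Fx urec uTu.
apply/seteqP; split => [v [vrec vmin]|_ ->]; last first.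
  split; first exact: recession_cone0.
  by move=> u /form_ge0; rewrite dot0l; lra.
apply: contrapT => v0; apply: phi_fin.
apply: (phi_continuous_avoids _ (lower_curvature w) _ cont) => a a0.
- exact: lower_curvature_Omega.
- exact/lower_curvature_dist/ltW.
apply: (phi_ninfty_of_recession _ x v) => //.
  exact: lower_curvature_Omega.
have vv : 0 < dot v v by rewrite neq0_dnorm_gt0//; apply/eqP.
have := vmin 0 (recession_cone0 w); rewrite dot0l /= !dotE.
have := mulr_gt0 a0 vv; lra.
Qed.

End Necessity.

(** * Upper semicontinuity of the optimal value *)

Section UpperSemicontinuity.
Context {R : realType} {H : completeNormedModType R} (dot : {dot H for idfun}).
Hypothesis dot_norm : is_inner_product dot.
Context {m : nat}.
Implicit Types (w : param H m) (x v : H) (i : 'I_m).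

(** Moving a feasible point slightly towards the Slater point makes all the
constraints strict, by convexity, and changes the objective little. *)
Lemma slater_perturb w x (a : R) : Omega dot w -> regular dot w ->
  F dot w x -> f dot x w < a ->
  exists2 y, (forall i, g dot i y w < 0) & f dot y w < a.
Proof.
move=> [_ sT Ow] [x0 x0P] Fx fa.
pose v := x0 - x.
pose b := dot (pT w x) v + dot (pc w) v.
pose q := 2^-1 * dot v (pT w v).
(* The objective varies by at most [t * (`|b| + `|q|)], less than the margin. *)
pose t := Num.min 1 ((a - f dot x w) / (2 * (`|b| + `|q| + 1))).
have nb := normr_ge0 b; have nq := normr_ge0 q.
have t0 : 0 < t by rewrite lt_min ltr01 divr_gt0//; lra.
have t1 : t <= 1 by rewrite ge_min lexx.
have tM : t * (2 * (`|b| + `|q| + 1)) <= a - f dot x w.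
  by rewrite -ler_pdivlMr ?ge_min ?lexx ?orbT//; lra.
exists (x + t *: v) => [i|].
  have [_ sA pA] := Ow i.
  rewrite /g (quadratic_line dot)//.
  have gx := Fx i; have gx0 := x0P i.
  have x0E : x0 = x + 1 *: v by rewrite scale1r addrC subrK.
  move: gx0; rewrite x0E /g (quadratic_line dot)//; move: gx; rewrite /g.
  have := pA v; set k := dot v _; set l := dot (pTi w i x) v + _.
  set c := _ + dot _ x => k0 gx gx0.
  have : 0 < t * - (c + 1 * l + 1 ^+ 2 * (2^-1 * k) + palpha w i).
    by rewrite mulr_gt0//; lra.
  have : 0 <= (1 - t) * - (c + palpha w i) by rewrite mulr_ge0//; lra.
  have : 0 <= t * (1 - t) * k by rewrite !mulr_ge0//; lra.
  lra.
rewrite /f (quadratic_line dot)// -/(f dot x w) -/b -/q.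
have : t * b <= t * `|b| by rewrite ler_wpM2l ?ler_norm// ltW.
have : t ^+ 2 * q <= t * `|q|.
  by rewrite expr2 -mulrA ler_wpM2l ?(ltW t0)// (le_trans (ler_norm _))//
    normrM gtr0_norm// ler_piMl.
lra.
Qed.

Lemma phi_near_lt w (w_ : nat -> param H m) (a : R) :
  Omega dot w -> (forall k, Omega dot (w_ k)) ->
  param_dist (w_ k) w @[k --> \oo] --> (0 : R) ->
  regular dot w -> (phi dot w < a%:E)%E ->
  \forall k \near \oo, (phi dot (w_ k) < a%:E)%E.
Proof.
move=> Ow Owk dk reg /ereal_inf_lt[_ [x Fx <-]]; rewrite lte_fin => fa.
have [y gy fy] := slater_perturb w x a Ow reg Fx fa.
pose M := (1 + `|y|) ^+ 2.
have M0 : 0 <= M by rewrite sqr_ge0.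
have small e : 0 < e -> \forall k \near \oo, param_dist (w_ k) w * M < e.
  move=> e0; have : param_dist (w_ k) w * M @[k --> \oo] --> 0 * M.
    exact: cvgMl.
  by rewrite mul0r => /cvgr_lt; apply.
have gk : \forall k \near \oo, forall i, g dot i y (w_ k) <= 0.
  apply: filter_forall => i; have := small (- g dot i y w).
  rewrite oppr_gt0 => /(_ (gy i)); apply: filterS => k.
  have := constraint_perturbation dot dot_norm (w_ k) w y i (Owk k) Ow.
  by rewrite -/M ler_norml => /andP[_]; lra.
have fk : \forall k \near \oo, f dot y (w_ k) < a.
  have := small (a - f dot y w); rewrite subr_gt0 => /(_ fy).
  apply: filterS => k.
  have := objective_perturbation dot dot_norm (w_ k) w y (Owk k) Ow.
  by rewrite -/M ler_norml => /andP[_]; lra.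
apply: filterS2 gk fk => k gk fk.
by apply: le_lt_trans (phi_le dot _ _ gk) _; rewrite lte_fin.
Qed.

End UpperSemicontinuity.

(** * Lower semicontinuity of the optimal value *)

Section LowerSemicontinuity.
Context {R : realType} {H : completeNormedModType R} (dot : {dot H for idfun}).
Hypothesis dot_norm : is_inner_product dot.
Context {m : nat} (w : param H m).
Hypothesis wOmega : Omega dot w.
Implicit Types (x v : H) (i : 'I_m).

(** Relaxation, by errors [d k] that may grow quadratically with [x k], of the
system [f dot y w <= mu], [g dot i y w <= 0].  The last clause is what keeps
track of the linear part of the constraints at infinity: it holds at feasible
points of nearby problems because their quadratic parts are nonnegative. *)
Definition almost_solution (mu : R) (d : nat -> R) (x : nat -> H) : Prop :=
  forall k,
    [/\ f dot (x k) w <= mu + d k * (1 + `|x k|) ^+ 2,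
        forall i, g dot i (x k) w <= d k * (1 + `|x k|) ^+ 2 &
        forall i, dot (pci w i) (x k) + palpha w i <= d k * (1 + `|x k|)].

Lemma almost_solution_comp mu d (x : nat -> H) (s : nat -> nat) :
  almost_solution mu d x -> almost_solution mu (d \o s) (x \o s).
Proof. by move=> + k => /(_ (s k)). Qed.

Lemma bounded_almost_solution mu d (x : nat -> H) (B : R) :
  weakly_lsc dot (fun x => dot x (pT w x)) ->
  almost_solution mu d x -> d k @[k --> \oo] --> (0 : R) ->
  (forall k, `|x k| <= B) ->
  exists2 y, F dot w y & f dot y w <= mu.
Proof.
move=> lscT sol d0 xB.
have [s [y [sge xsy]]] := bounded_weakly_cvg_subsequence dot dot_norm x B xB.
have ds0 := subseq_cvg _ _ _ sge d0.
have {}sol := almost_solution_comp _ _ _ s sol.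
pose e k := `|d (s k)| * (1 + B) ^+ 2.
have e0 : e k @[k --> \oo] --> (0 : R).
  rewrite -(mul0r ((1 + B) ^+ 2)); apply: cvgMl; rewrite -(normr0 R).
  exact: cvg_norm.
have de k : d (s k) * (1 + `|x (s k)|) ^+ 2 <= e k.
  apply: le_trans (_ : `|d (s k)| * (1 + `|x (s k)|) ^+ 2 <= _).
    by rewrite ler_wpM2r ?sqr_ge0 ?ler_norm.
  have := normr_ge0 (x (s k)); have := xB (s k) => xsB nx.
  by rewrite ler_wpM2l// ler_pXn2r ?nnegrE//; lra.
have [_ _ OT] := wOmega.
exists y => [i|].
  have [_ sA pA] := OT i.
  have lim : 2 * (e k - dot (pci w i) (x (s k)) - palpha w i) @[k --> \oo] -->
      2 * (0 - dot (pci w i) y - palpha w i).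
    apply: cvgMr; apply: cvgB; last exact: cvg_cst.
    by apply: cvgB => //; exact: xsy.
  have xi k : dot ((x \o s) k) (pTi w i ((x \o s) k)) <=
      2 * (e k - dot (pci w i) (x (s k)) - palpha w i).
    have [_ /(_ i) + _] := sol k; rewrite /g /=; have := de k; lra.
  by have := psd_le_weak_lim dot _ _ _ _ _ sA pA xsy xi lim; rewrite /g; lra.
have lim : 2 * (e k - dot (pc w) (x (s k)) + mu) @[k --> \oo] -->
    2 * (0 - dot (pc w) y + mu).
  apply: cvgMr; apply: cvgD; last exact: cvg_cst.
  by apply: cvgB => //; exact: xsy.
have xi k : dot ((x \o s) k) (pT w ((x \o s) k)) <=
    2 * (e k - dot (pc w) (x (s k)) + mu).
  have [+ _ _] := sol k; rewrite /f /=; have := de k; lra.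
by have := weakly_lsc_le_lim dot _ _ _ _ _ lscT xsy xi lim; rewrite /f; lra.
Qed.

Lemma quadratic_scale (A : {linear H -> H}) (r : R) (v : H) :
  dot (r *: v) (A (r *: v)) = r ^+ 2 * dot v (A v).
Proof. by rewrite linearZZ dotZl dotZr mulrA expr2. Qed.

(** What is left of a quadratic inequality along a ray after division by
[r ^+ 2], when [r] is at least [n + 1] and the errors are quadratic. *)
Lemma rescaled_quadratic_bound (q l a L d r : R) (n : nat) :
  n.+1%:R <= r -> `|l| <= L ->
  2^-1 * (r ^+ 2 * q) + r * l + a <= d * (1 + r) ^+ 2 ->
  q <= 2 * (4 * `|d| + (L + `|a|) * n.+1%:R^-1).
Proof.
move=> nr lL h; have n0 : 0 < n.+1%:R :> R by [].
have n1 : 1 <= n.+1%:R :> R by rewrite ler1n.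
set c := n.+1%:R^-1; have c0 : 0 < c by rewrite invr_gt0.
have cr : 1 <= c * r by rewrite mulrC ler_pdivlMr// mul1r.
have r1 : 1 <= r by lra.
have r0 : 0 < r ^+ 2 by rewrite exprn_gt0//; lra.
rewrite -(ler_pM2l r0).
(* The factor [4] comes from [1 + r <= 2 * r]. *)
have h1 : d * (1 + r) ^+ 2 <= `|d| * (4 * r ^+ 2).
  apply: le_trans (_ : `|d| * (1 + r) ^+ 2 <= _).
    by rewrite ler_wpM2r ?sqr_ge0 ?ler_norm.
  by rewrite ler_wpM2l//; nra.
have L0 : 0 <= L by exact: le_trans lL.
have h2 : - (r * l) <= r ^+ 2 * (L * c).
  have : 0 <= L * r * (c * r - 1) by rewrite !mulr_ge0//; lra.
  have : 0 <= r * (L + l).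
    by rewrite mulr_ge0//; move: lL; rewrite ?ler_norml => ?; lra.
  rewrite expr2; nra.
have h3 : - a <= r ^+ 2 * (`|a| * c).
  have := ler_norm (- a); rewrite normrN.
  have : 0 <= `|a| * (r * (c * r) - 1).
    by rewrite mulr_ge0//; nra.
  rewrite expr2; lra.
lra.
Qed.

(** Directions of an almost solution escaping to infinity accumulate weakly at a
recession vector on which the objective form is nonpositive, hence at [0]; the
Legendre property makes this convergence strong, although these directions are
unit vectors. *)
Lemma almost_solution_not_escaping mu d (x : nat -> H) :
  legendre_form dot (fun x => dot x (pT w x)) ->
  (forall v, recession_cone dot w v -> dot v (pT w v) <= 0 -> v = 0) ->
  almost_solution mu d x -> d k @[k --> \oo] --> (0 : R) ->
  ~ (forall k, k.+1%:R <= `|x k|).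
Proof.
move=> [lscT strongT] rec0 sol d0 xk.
pose r k := `|x k|; pose v k := (r k)^-1 *: x k.
have r0 k : 0 < r k by apply: lt_le_trans (xk k).
have xE k : x k = r k *: v k by rewrite scalerA divff ?scale1r// gt_eqF.
have v1 k : `|v k| = 1.
  by rewrite normrZ normfV gtr0_norm// -/(r k) mulVf// gt_eqF.
have cv c k : `|dot c (v k)| <= `|c|.
  by rewrite (le_trans (cauchy_schwarz _ dot_norm _ _))// v1 mulr1.
have dotrv (A : {linear H -> H}) k :
    dot (x k) (A (x k)) = r k ^+ 2 * dot (v k) (A (v k)).
  by rewrite {1 2}xE quadratic_scale.
pose bound (a : R) k := 2 * (4 * `|d k| + a * k.+1%:R^-1).
have bound0 a : bound a k @[k --> \oo] --> (0 : R).
  have -> : (0 : R) = 2 * (4 * `|0 : R| + a * 0).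
    by rewrite normr0 !mulr0 addr0 mulr0.
  apply: cvgMr; apply: cvgD; apply: cvgMr; first exact: cvg_norm.
  exact: cvg_harmonic.
have vT k : dot (v k) (pT w (v k)) <= bound (`|pc w| + `|- mu|) k.
  have [h _ _] := sol k.
  apply: (rescaled_quadratic_bound _ (dot (pc w) (v k)) _ _ _ (r k)) => //.
  rewrite -dotrv -dotZr -xE; move: h; rewrite /f -/(r k); lra.
have vTi i k : dot (v k) (pTi w i (v k)) <=
    bound (`|pci w i| + `|palpha w i|) k.
  have [_ /(_ i) h _] := sol k.
  apply: (rescaled_quadratic_bound _ (dot (pci w i) (v k)) _ _ _ (r k)) => //.
  by rewrite -dotrv -dotZr -xE.
have vc i k : dot (pci w i) (v k) <= bound `|palpha w i| k.
  have [_ _ /(_ i)] := sol k; rewrite {1}xE dotZr -/(r k) => h.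
  rewrite -(ler_pM2l (r0 k)) /bound; set c := k.+1%:R^-1.
  have c0 : 0 < c by rewrite invr_gt0.
  have cr : 1 <= c * r k by rewrite mulrC ler_pdivlMr// mul1r.
  have r1 : 1 <= r k by apply: le_trans (xk k); rewrite ler1n.
  have : 0 <= `|palpha w i| * (c * r k - 1) by rewrite mulr_ge0//; lra.
  have : 0 <= `|d k| * (r k - 1) by rewrite mulr_ge0//; lra.
  have : d k * (1 + r k) <= `|d k| * (1 + r k).
    by rewrite ler_wpM2r ?ler_norm//; lra.
  have := ler_norm (- palpha w i); rewrite normrN.
  have : 0 <= `|palpha w i| * (c * r k) by rewrite mulr_ge0//; lra.
  have : 0 <= `|d k| * r k by rewrite mulr_ge0//; lra.
  have := normr_ge0 (d k).
  lra.
have v_le1 k : `|v k| <= 1 by rewrite v1.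
have [s [u [sge vsu]]] :=
  bounded_weakly_cvg_subsequence dot dot_norm v 1 v_le1.
have bs0 a := subseq_cvg _ _ _ sge (bound0 a).
have u0 : u = 0.
  apply: rec0 => [i|].
    have [_ _ /(_ i)[_ sA pA]] := wOmega; split.
      apply: (psd_isotropic_ker dot dot_norm) => //.
      apply: (psd_le_weak_lim dot _ _ _ _ _ sA pA vsu _ (bs0 _)).
      by move=> k; exact: vTi.
    by apply: (ler_cvg_to (vsu (pci w i)) (bs0 _)); apply: nearW => k;
      exact: vc.
  apply: (weakly_lsc_le_lim dot _ _ _ _ _ lscT vsu _ (bs0 _)) => k; exact: vT.
move: vsu; rewrite u0 => vs0.
have form0 : dot (v (s k)) (pT w (v (s k))) @[k --> \oo] -->
    dot (0 : H) (pT w 0).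
  rewrite dot0l; apply/cvgrPdist_lt => e e0.
  have lo : \forall k \near \oo, - e < dot (v (s k)) (pT w (v (s k))).
    by apply: (weakly_lsc_near dot _ _ _ _ lscT vs0); rewrite dot0l oppr_lt0.
  have up : \forall k \near \oo, bound (`|pc w| + `|- mu|) (s k) < e.
    exact: (cvgr_lt _ (bs0 (`|pc w| + `|- mu|)) _ e0).
  apply: filterS2 lo up => k lo /(le_lt_trans (vT (s k))) up.
  by rewrite sub0r normrN ltr_norml lo up.
have /cvgrPdist_lt/(_ 1 ltr01)/filter_ex[k] := strongT _ _ vs0 form0.
by rewrite sub0r normrN /= v1 ltxx.
Qed.

(** Either some ball contains infinitely many terms, or a subsequence escapes to
infinity at least as fast as the index. *)
Lemma almost_solution_limit mu d (x : nat -> H) :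
  legendre_form dot (fun x => dot x (pT w x)) ->
  (forall v, recession_cone dot w v -> dot v (pT w v) <= 0 -> v = 0) ->
  almost_solution mu d x -> d k @[k --> \oo] --> (0 : R) ->
  exists2 y, F dot w y & f dot y w <= mu.
Proof.
move=> legT rec0 sol d0.
have [[B bounded]|escaping] :=
    pselect (exists B, forall n, exists k, (n <= k)%N /\ `|x k| <= B).
  have [s sP] := choice bounded.
  have sge n : (n <= s n)%N by have [] := sP n.
  apply: (bounded_almost_solution mu (d \o s) (x \o s) B legT.1).
  - exact: almost_solution_comp.
  - exact: subseq_cvg sge d0.
  - by move=> k; have [] := sP k.
have far_out n : exists k, (n <= k)%N /\ n.+1%:R <= `|x k|.
  apply: contrapT => /forallNP far.
  apply: escaping; exists n.+1%:R => p; exists (maxn n p); split.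
    exact: leq_maxr.
  rewrite leNgt; apply/negP => /ltW big; apply: (far (maxn n p)).
  by split=> //; exact: leq_maxl.
have [s sP] := choice far_out.
have sge n : (n <= s n)%N by have [] := sP n.
exfalso; apply: (almost_solution_not_escaping mu (d \o s) (x \o s) legT rec0).
- exact: almost_solution_comp.
- exact: subseq_cvg sge d0.
- by move=> k; have [] := sP k.
Qed.

Lemma nearby_feasible_almost_solution (w' : param H m) mu x : Omega dot w' ->
  F dot w' x -> f dot x w' <= mu ->
  let d := param_dist w' w in
  [/\ f dot x w <= mu + d * (1 + `|x|) ^+ 2,
      forall i, g dot i x w <= d * (1 + `|x|) ^+ 2 &
      forall i, dot (pci w i) x + palpha w i <= d * (1 + `|x|)].
Proof.
move=> Ow' Fx fx d; split=> [|i|i].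
- have := objective_perturbation dot dot_norm w' w x Ow' wOmega.
  by rewrite -/d ler_norml => /andP[+ _]; lra.
- have := constraint_perturbation dot dot_norm w' w x i Ow' wOmega.
  by rewrite -/d ler_norml => /andP[+ _]; have := Fx i; lra.
have := affine_perturbation dot dot_norm w' w x i.
rewrite -/d ler_norml => /andP[+ _].
have := Fx i; rewrite /g; have [_ _ /(_ i)[_ _ /(_ x)]] := Ow'; lra.
Qed.

Lemma phi_near_ge (w_ : nat -> param H m) (a : R) :
  legendre_form dot (fun x => dot x (pT w x)) ->
  SolQPR dot w = [set 0] -> (forall k, Omega dot (w_ k)) ->
  param_dist (w_ k) w @[k --> \oo] --> (0 : R) ->
  (a%:E < phi dot w)%E ->
  \forall k \near \oo, (a%:E <= phi dot (w_ k))%E.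
Proof.
move=> legT sol0 Owk d0 aphi.
have rec0 v : recession_cone dot w v -> dot v (pT w v) <= 0 -> v = 0.
  move=> vrec vTv; have [_ zmin] : SolQPR dot w 0 by rewrite sol0.
  suff : SolQPR dot w v by rewrite sol0.
  split=> // u /zmin; rewrite dot0l; lra.
apply: contrapT => notnear.
have bad n : exists k, (n <= k)%N /\
    exists2 x, F dot (w_ k) x & f dot x (w_ k) <= a.
  apply: contrapT => /forallNP good; apply: notnear; exists n => // k /= nk.
  rewrite leNgt; apply/negP => /ereal_inf_lt[_ [x Fx <-]].
  by rewrite lte_fin => /ltW fx; apply: (good k); split=> //; exists x.
have [s sP] := choice bad.
have /choice[x xP] n : exists x, F dot (w_ (s n)) x /\ f dot x (w_ (s n)) <= a.
  by have [_ [x ? ?]] := sP n; exists x.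
have sge n : (n <= s n)%N by have [] := sP n.
have ds0 := subseq_cvg _ _ _ sge d0.
have xsol : almost_solution a (fun n => param_dist (w_ (s n)) w) x.
  by move=> n; have [? ?] := xP n; exact: nearby_feasible_almost_solution.
have [y Fy fy] := almost_solution_limit _ _ _ legT rec0 xsol ds0.
have := le_lt_trans (phi_le dot _ _ Fy) (le_lt_trans (_ : _ <= a%:E)%E aphi).
by rewrite lee_fin ltxx => /(_ fy).
Qed.

End LowerSemicontinuity.

(** * The continuity criterion *)

Theorem theorem3p1 (R : realType) (H : completeNormedModType R)
    (dot : {dot H for idfun}) (dot_norm : is_inner_product dot)
    (m : nat) (m_ge1 : (1 <= m)%N)
    (w : param H m) (wOmega : Omega dot w)
    (T_legendre : legendre_form dot (fun x => dot x (pT w x)))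
    (phi_npinfty : phi dot w <> +oo%E) (phi_nninfty : phi dot w <> -oo%E) :
  phi_continuous_at dot w <->
    (SolQPR dot w = [set 0] /\ regular dot w).
Proof.
split=> [cont|[sol0 reg] w_ Owk d0].
  by split; [exact: continuous_SolQPR|exact: continuous_regular].
have [r phiE] : exists r, phi dot w = r%:E.
  by case: (phi dot w) phi_npinfty phi_nninfty => [r|//|//]; exists r.
have bounds e : 0 < e -> \forall k \near \oo,
    ((r - e)%:E <= phi dot (w_ k))%E /\ (phi dot (w_ k) < (r + e)%:E)%E.
  move=> e0.
  have lo : ((r - e)%:E < phi dot w)%E by rewrite phiE lte_fin; lra.
  have up : (phi dot w < (r + e)%:E)%E by rewrite phiE lte_fin; lra.
  have near_lo :=
    phi_near_ge dot dot_norm w wOmega w_ _ T_legendre sol0 Owk d0 lo.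
  have near_up := phi_near_lt dot dot_norm w w_ _ wOmega Owk d0 reg up.
  by apply: filterS2 near_lo near_up => k.
rewrite phiE; apply/fine_cvgP; split.
  apply: filterS (bounds 1 ltr01) => k [].
  by case: (phi dot (w_ k)).
apply/cvgrPdist_le => e e0; apply: filterS (bounds e e0) => k [] /=.
case: (phi dot (w_ k)) => [s| |] //; rewrite lee_fin lte_fin /= => ? ?.
by rewrite ler_norml; apply/andP; split; lra.
Qed.
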